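(* Let $\mathcal{B}=(a_1,a_2)\subset\mathbb{R}$, $\tau>0$, let $\rho_0>0$ and $c$ be constants, and let $\sigma=\tfrac12\left(\rho_0(\partial_0 I)^2-c(\partial_1 I)^2\right)$, where $z=(z_0,z_1)=(t,x)$ and $\partial_\mu=\partial/\partial z_\mu$. Let $I$ be a smooth solution on $[0,\tau]\times\mathcal{B}$ of the Euler–Lagrange equation $\frac{\partial}{\partial z_\mu}\left(\frac{\partial\sigma}{\partial(\partial_\mu I)}\right)=0$. Then the tensor $$T_{\mu\eta}=\frac{\partial\sigma}{\partial(\partial_\mu I)}\cdot\frac{\partial I}{\partial z_\eta}-\delta_{\mu\eta}\,\sigma,\qquad \mu,\eta\in\{0,1\},$$ satisfies the system of conservation laws $$\frac{\partial T_{\mu\eta}}{\partial z_\mu}=0,\qquad \eta=0,1 .$$ In particular, $\pi:=T_{00}=\rho_0\left(\frac{\partial I}{\partial t}\right)^2-\sigma$ satisfies $$\frac{\partial\pi}{\partial t}+\frac{\partial}{\partial x}\left(\frac{\partial I}{\partial t}\,\frac{\partial\sigma}{\partial(\partial_x I)}\right)=0 .$$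
   Context: Repeated index $\mu\in\{0,1\}$ is summed; $\delta_{\mu\eta}$ is the Kronecker delta. Here $\frac{\partial\sigma}{\partial(\partial_0 I)}=\rho_0\,\partial_t I$ and $\frac{\partial\sigma}{\partial(\partial_1 I)}=\frac{\partial\sigma}{\partial(\partial_x I)}=-c\,\partial_x I$. *)

(* Defs.v *)
From HB Require Import structures.
From mathcomp Require Import all_boot all_order all_algebra.
From mathcomp Require Import all_classical all_reals all_analysis.

Set Implicit Arguments.
Unset Strict Implicit.
Unset Printing Implicit Defensive.

Import Order.TTheory GRing.Theory Num.Theory.
Import numFieldNormedType.Exports.

Local Open Scope classical_set_scope.
Local Open Scope ring_scope.

(* A point z = (z_0, z_1) = (t, x) is a row vector; [z 0 0] is t and [z 0 1]
   is x. *)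
Definition spacetime (R : realType) (a1 a2 tau : R) : set 'rV[R]_2 :=
  [set z | 0 <= z 0 0 <= tau /\ a1 < z 0 1 < a2].

(* Partial derivatives of a function on a domain D that need not be open: the
   library's directional difference quotient, with the increment h restricted
   to those h for which z + h e_mu stays in D. At an interior point this is the
   usual partial derivative; at t = 0 and t = tau the derivative in t is the
   one-sided one. As with [derive], the value [pd] is meaningful only where the
   limit exists, which is what [pderivable] asserts. *)
Definition pquot (R : realType) (D : set 'rV[R]_2) (f : 'rV[R]_2 -> R)
    (mu : 'I_2) (z : 'rV[R]_2) : set_system R :=
  (fun h : R => h^-1 * (f (z + h *: delta_mx 0 mu) - f z))
    @ within [set h : R | D (z + h *: delta_mx 0 mu)] 0^'.

Definition pderivable (R : realType) (D : set 'rV[R]_2) (f : 'rV[R]_2 -> R)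
    (mu : 'I_2) (z : 'rV[R]_2) : Prop :=
  cvg (pquot D f mu z).

Definition pd (R : realType) (D : set 'rV[R]_2) (mu : 'I_2)
    (f : 'rV[R]_2 -> R) (z : 'rV[R]_2) : R :=
  lim (pquot D f mu z).

(* C^infinity on D, up to the part of the boundary contained in D: for every
   word s of indices, the iterated partial derivative along s is continuous on
   D and has both partial derivatives at each point of D. *)
Definition smooth_on (R : realType) (D : set 'rV[R]_2) (f : 'rV[R]_2 -> R)
    : Prop :=
  forall s : seq 'I_2,
    {within D, continuous (foldr (pd D) f s)} /\
    forall (mu : 'I_2) (z : 'rV[R]_2), D z ->
      pderivable D (foldr (pd D) f s) mu z.

(* d (F mu) / d z_mu = 0 on D, summed over mu. *)
Definition conservation_law (R : realType) (D : set 'rV[R]_2)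
    (F : 'I_2 -> 'rV[R]_2 -> R) : Prop :=
  forall z : 'rV[R]_2, D z ->
    (forall mu : 'I_2, pderivable D (F mu) mu z) /\
    \sum_(mu < 2) pd D mu (F mu) z = 0.

(* sigma as a function of the gradient variables p = (d_0 I, d_1 I). *)
Definition sigma (R : realType) (rho0 c : R) (p : 'rV[R]_2) : R :=
  2^-1 * (rho0 * p 0 0 ^+ 2 - c * p 0 1 ^+ 2).

Definition grad (R : realType) (D : set 'rV[R]_2) (I : 'rV[R]_2 -> R)
    (z : 'rV[R]_2) : 'rV[R]_2 :=
  \row_(mu < 2) pd D mu I z.

Definition sigma_at (R : realType) (D : set 'rV[R]_2) (rho0 c : R)
    (I : 'rV[R]_2 -> R) (z : 'rV[R]_2) : R :=
  sigma rho0 c (grad D I z).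

(* d sigma / d (d_mu I): the mu-th partial derivative of [sigma] in the
   gradient variables, evaluated at the gradient of I. *)
Definition dsigma (R : realType) (D : set 'rV[R]_2) (rho0 c : R)
    (I : 'rV[R]_2 -> R) (mu : 'I_2) (z : 'rV[R]_2) : R :=
  'D_(delta_mx 0 mu) (sigma rho0 c) (grad D I z).

Definition euler_lagrange (R : realType) (D : set 'rV[R]_2) (rho0 c : R)
    (I : 'rV[R]_2 -> R) : Prop :=
  conservation_law D (dsigma D rho0 c I).

Definition tensorT (R : realType) (D : set 'rV[R]_2) (rho0 c : R)
    (I : 'rV[R]_2 -> R) (mu eta : 'I_2) (z : 'rV[R]_2) : R :=
  dsigma D rho0 c I mu z * pd D eta I z
  - (mu == eta)%:R * sigma_at D rho0 c I z.

(* Main.v *)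
Require Import Defs.
From HB Require Import structures.
From mathcomp Require Import all_boot all_order all_algebra.
From mathcomp Require Import all_classical all_reals all_analysis.
From mathcomp Require Import ring lra.

(** With u = d_t I and v = d_x I, the divergence of T_{. eta} is
    (d_eta I) * (rho0 u_t - c v_x) plus a multiple of v_t - u_x.  The first
    term vanishes by the Euler-Lagrange equation and the second by the symmetry
    of mixed partials, which has to be established up to t = 0 and t = tau,
    where the derivatives in t are one-sided. *)

Set Implicit Arguments.
Unset Strict Implicit.
Unset Printing Implicit Defensive.

Import Order.TTheory GRing.Theory Num.Theory.
Import numFieldNormedType.Exports.

Local Open Scope classical_set_scope.
Local Open Scope ring_scope.

(** * Partial derivatives at interior points *)

Lemma within_eqF (T : Type) (F : set_system T) (P : set T) :
  Filter F -> F P -> within P F = F.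
Proof.
move=> FF FP; apply/seteqP; split=> A.
- by rewrite /within /= => FA; apply: filterS2 FP FA => x Px; exact.
- by rewrite /within /= => FA; apply: filterS FA => x Ax.
Qed.

Lemma nbhs_line (R : realType) (D : set 'rV[R]_2) (v z : 'rV[R]_2) :
  nbhs z D -> \forall h \near (0 : R), D (z + h *: v).
Proof.
have : (z + h *: v) @[h --> (0 : R)] --> z + 0 *: v.
  by apply: cvgD; [exact: cvg_cst | apply: cvgZr_tmp; exact: cvg_id].
by rewrite scale0r addr0 => /(_ D) hD /hD.
Qed.

Lemma pquot_nbhs (R : realType) (D : set 'rV[R]_2) (f : 'rV[R]_2 -> R)
    (mu : 'I_2) (z : 'rV[R]_2) :
  nbhs z D ->
  pquot D f mu z =
  (fun h : R => h^-1 * (f (z + h *: delta_mx 0 mu) - f z)) @ 0^'.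
Proof.
move=> /(nbhs_line (delta_mx 0 mu)) hD; rewrite /pquot within_eqF//.
exact: nbhs_dnbhs.
Qed.

(** Near an interior point the restriction on the increment is void, so [pd] is an ordinary
    derivative along a coordinate line. This makes the one-variable mean value theorem
    applicable. *)
Lemma pderivable_is_derive (R : realType) (D : set 'rV[R]_2)
    (f : 'rV[R]_2 -> R) (mu : 'I_2) (y : 'rV[R]_2) (s : R) :
  nbhs (y + s *: delta_mx 0 mu) D ->
  pderivable D f mu (y + s *: delta_mx 0 mu) ->
  is_derive s 1 (fun r : R => f (y + r *: delta_mx 0 mu))
    (pd D mu f (y + s *: delta_mx 0 mu)).
Proof.
move=> yD; rewrite /pderivable /pd pquot_nbhs // => fy.
have E : (fun h : R => h^-1 *: (((fun r : R => f (y + r *: delta_mx 0 mu))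
    \o shift s) (h *: 1) - f (y + s *: delta_mx 0 mu))) =
  (fun h : R => h^-1 * (f (y + s *: delta_mx 0 mu + h *: delta_mx 0 mu)
    - f (y + s *: delta_mx 0 mu))).
  apply/funext => h /=; rewrite /GRing.scale /= mulr1.
  by rewrite -addrA -scalerDl [s + h]addrC.
by split; rewrite /derivable /derive E.
Qed.

(** * Symmetry of mixed partial derivatives *)

Lemma MVT_is_derive (R : realType) (f df : R -> R) (a b : R) : a < b ->
  (forall x, a <= x <= b -> is_derive x 1 f (df x)) ->
  exists2 c, a < c < b & f b - f a = df c * (b - a).
Proof.
move=> ab fdf.
have fdf' x : x \in `]a, b[ -> is_derive x 1 f (df x).
  by rewrite in_itv /= => /andP[/ltW ax /ltW xb]; apply: fdf; rewrite ax xb.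
have fc : {within `[a, b], continuous f}.
  by apply: derivable_within_continuous => x; rewrite in_itv /= => /fdf [].
by have [c] := MVT ab fdf' fc; rewrite in_itv /= => abc E; exists c.
Qed.

(** The mean value theorem is applied twice: first in direction [mu] to the difference of [f] on two
    parallel sides of the square, then in direction [nu] to [pd D mu f] on the segment through the
    intermediate point found first. *)
Lemma second_difference (R : realType) (D : set 'rV[R]_2)
    (f : 'rV[R]_2 -> R) (mu nu : 'I_2) (w : 'rV[R]_2) (h : R) :
  0 < h ->
  (forall s r, 0 <= s <= h -> 0 <= r <= h ->
     nbhs (w + s *: delta_mx 0 mu + r *: delta_mx 0 nu) D) ->
  (forall z, D z -> pderivable D f mu z) ->
  (forall z, D z -> pderivable D (pd D mu f) nu z) ->
  exists s r, [/\ 0 < s < h, 0 < r < h &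
    f (w + h *: delta_mx 0 mu + h *: delta_mx 0 nu)
    - f (w + h *: delta_mx 0 nu) - (f (w + h *: delta_mx 0 mu) - f w)
    = pd D nu (pd D mu f) (w + s *: delta_mx 0 mu + r *: delta_mx 0 nu)
      * h * h].
Proof.
move=> h0 wD f1 f2; set em := delta_mx 0 mu; set en := delta_mx 0 nu.
have h0h : 0 <= h <= h by lra.
have h00 : 0 <= (0 : R) <= h by lra.
have [|s sh Es] := @MVT_is_derive R
  (fun s => f (w + h *: en + s *: em) - f (w + s *: em))
  (fun s => pd D mu f (w + h *: en + s *: em) - pd D mu f (w + s *: em)) 0 h h0.
  move=> s sh; apply: is_deriveB; apply: pderivable_is_derive.
  - by rewrite addrAC; apply: wD.
  - by apply: f1; apply: nbhs_singleton; rewrite addrAC; apply: wD.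
  - by have := wD s 0 sh h00; rewrite scale0r addr0.
  - apply: f1; apply: nbhs_singleton.
    by have := wD s 0 sh h00; rewrite scale0r addr0.
have sh' : 0 <= s <= h by case/andP: sh => /ltW -> /ltW ->.
have [|r rh Er] := @MVT_is_derive R
  (fun r => pd D mu f (w + s *: em + r *: en))
  (fun r => pd D nu (pd D mu f) (w + s *: em + r *: en)) 0 h h0.
  move=> r rh; apply: pderivable_is_derive; first exact: wD.
  by apply: f2; apply: nbhs_singleton; apply: wD.
exists s, r; split => //; move: Es Er; rewrite !scale0r !addr0 !subr0.
rewrite [w + h *: en + h *: em]addrAC [w + h *: en + s *: em]addrAC => Es Er.
by rewrite -Er -Es; ring.
Qed.

Lemma nbhs_rectangle (R : realType) (U : set 'rV[R]_2) (mu nu : 'I_2)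
    (w : 'rV[R]_2) :
  nbhs w U -> exists2 h : R, 0 < h &
  forall s r, 0 <= s <= h -> 0 <= r <= h ->
     nbhs (w + s *: delta_mx 0 mu + r *: delta_mx 0 nu) U.
Proof.
move=> wU.
have : (w + p.1 *: delta_mx 0 mu + p.2 *: delta_mx 0 nu)
    @[p --> ((0, 0) : R * R)] --> 
   w + (0 : R) *: delta_mx 0 mu + (0 : R) *: delta_mx 0 nu.
  apply: cvgD; [apply: cvgD; [exact: cvg_cst|]|]; apply: cvgZr_tmp.
  - exact: cvg_fst.
  - exact: cvg_snd.
(* Pulling back the interior of [U], and not [U], makes [U] a neighbourhood of each point of the
   rectangle. *)
rewrite !scale0r !addr0 => /(_ _ (nbhs_interior wU)) /= /nbhs_ballP [e /= e0 eU].
exists (e / 2); first by rewrite divr_gt0.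
move=> s r sh rh; apply: (eU (s, r)); split; rewrite /ball /= sub0r normrN;
  rewrite ger0_norm; lra.
Qed.

(* At an interior point both mixed partials equal the limit of the same second
   difference quotient; continuity then carries the identity to the rest of D. *)
Lemma pd_comm (R : realType) (D : set 'rV[R]_2) (f : 'rV[R]_2 -> R)
    (mu nu : 'I_2) (z : 'rV[R]_2) :
  D `<=` closure D^° -> smooth_on D f -> D z ->
  pd D mu (pd D nu f) z = pd D nu (pd D mu f) z.
Proof.
move=> Dcl fs Dz.
have [_ f1] := fs [::].
have [_ fmu] := fs [:: mu]; have [_ fnu] := fs [:: nu].
have [/subspace_continuousP cmn _] := fs [:: mu; nu].
have [/subspace_continuousP cnm _] := fs [:: nu; mu].
have {}cmn := cmn z Dz; have {}cnm := cnm z Dz; move: cmn cnm => /= cmn cnm.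
(* It suffices to bound the distance of the two mixed partials by every [e > 0]. *)
apply/eqP; rewrite -subr_eq0 -normr_le0; apply/ler_addgt0Pr => e e0.
rewrite add0r.
have e2 : 0 < e / 2 by rewrite divr_gt0.
set F := pd D mu (pd D nu f) in cmn *.
set G := pd D nu (pd D mu f) in cnm *.
have HF : nbhs z [set y | D y -> `|F z - F y| < e / 2].
  exact: (cmn _ (nbhsx_ballx _ _ e2)).
have HG : nbhs z [set y | D y -> `|G z - G y| < e / 2].
  exact: (cnm _ (nbhsx_ballx _ _ e2)).
have HFG := @filterI _ _ (nbhs_filter z) _ _ HF HG.
(* As [z] may lie on the boundary, the square is based at a nearby interior point [w], chosen where
   both mixed partials stay within [e / 2] of their values at [z]. *)
have [w [Dw Uw]] := Dcl z Dz _ (nbhs_interior HFG).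
have wDU := @filterI _ _ (nbhs_filter w) _ _ Dw Uw.
have [h h0 hDU] := nbhs_rectangle mu nu wDU.
have hD s r : 0 <= s <= h -> 0 <= r <= h ->
     nbhs (w + s *: delta_mx 0 mu + r *: delta_mx 0 nu) D.
  by move=> sh rh; apply: filterS (hDU s r sh rh) => x [].
have hp s r : 0 < s < h -> 0 < r < h ->
     let p := w + s *: delta_mx 0 mu + r *: delta_mx 0 nu in
     `|F z - F p| < e / 2 /\ `|G z - G p| < e / 2.
  move=> /andP[s0 sh] /andP[r0 rh] p.
  have sh' : 0 <= s <= h by rewrite (ltW s0) (ltW sh).
  have rh' : 0 <= r <= h by rewrite (ltW r0) (ltW rh).
  have [Dp [U1 U2]] := nbhs_singleton (hDU s r sh' rh').
  by split; [apply: U1|apply: U2].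
have hD' r s : 0 <= r <= h -> 0 <= s <= h ->
     nbhs (w + r *: delta_mx 0 nu + s *: delta_mx 0 mu) D.
  by move=> rh sh; rewrite addrAC; apply: hD.
have [s [r [sh rh E1]]] := second_difference h0 hD (f1 mu) (fmu nu).
have [r' [s' [rh' sh' E2]]] := second_difference h0 hD' (f1 nu) (fnu mu).
have [_ A1] := hp _ _ sh rh.
have [A2 _] := hp _ _ sh' rh'.
move: E1 E2 A1 A2; rewrite [w + _ + s' *: _]addrAC.
rewrite [w + h *: delta_mx 0 nu + _]addrAC.
rewrite -/F -/G; set P := G (_ + _); set Q := F (_ + _).
clearbody P Q => E1 E2 A1 A2.
(* Both orders of differencing give the same number, equal to [P * h * h] and to [Q * h * h]. *)
have PQ : P = Q.
  apply: (mulIf (lt0r_neq0 h0)); apply: (mulIf (lt0r_neq0 h0)).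
  have swap (x y a b : R) : x - y - (a - b) = x - a - (y - b) by ring.
  by rewrite -E1 -E2; exact: swap.
rewrite PQ distrC in A1; rewrite [e]splitr.
by apply: le_trans (ltW (ltrD A2 A1)); exact: ler_distD.
Qed.

(** * Differentiation rules for partial derivatives relative to a domain *)

(** Existence and value in one relation: the sum, scaling and product rules then hold along the
    restricted filter without knowing that it is proper. Properness enters in [is_pd_pd], where the
    limit must be unique. *)
Definition is_pd (R : realType) (D : set 'rV[R]_2) (f : 'rV[R]_2 -> R)
    (mu : 'I_2) (z : 'rV[R]_2) (l : R) : Prop :=
  pquot D f mu z --> l.

Section is_pd_rules.
Variables (R : realType) (D : set 'rV[R]_2) (mu : 'I_2) (z : 'rV[R]_2).
Implicit Types (f g : 'rV[R]_2 -> R) (k a b : R).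

Let W := within [set h : R | D (z + h *: delta_mx 0 mu)] 0^'.

Lemma is_pdD f g a b : is_pd D f mu z a -> is_pd D g mu z b ->
  is_pd D (fun y => f y + g y) mu z (a + b).
Proof.
move=> fa gb; have : (fun h : R =>
    h^-1 * (f (z + h *: delta_mx 0 mu) - f z)
    + h^-1 * (g (z + h *: delta_mx 0 mu) - g z)) @ W --> a + b.
  exact: (cvgD fa gb).
by apply: cvg_trans; apply: near_eq_cvg; apply: nearW => h /=; ring.
Qed.

Lemma is_pdZ k f a : is_pd D f mu z a ->
  is_pd D (fun y => k * f y) mu z (k * a).
Proof.
move=> fa; have : (fun h : R =>
    k * (h^-1 * (f (z + h *: delta_mx 0 mu) - f z))) @ W --> k * a.
  exact: (cvgMl_tmp fa).
by apply: cvg_trans; apply: near_eq_cvg; apply: nearW => h /=; ring.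
Qed.

Lemma is_pdM f g a b : is_pd D f mu z a -> is_pd D g mu z b ->
  is_pd D (fun y => f y * g y) mu z (a * g z + f z * b).
Proof.
move=> fa gb; pose q f h := h^-1 * (f (z + h *: delta_mx 0 mu) - f z).
have h0 : (fun h : R => h) @ W --> (0 : R).
  apply: cvg_trans (@nbhs_dnbhs _ (0 : R)); exact: cvg_within.
(* The usual product-rule splitting, with the value of [g] at the shifted point written as
   [g z + h * q g h]; its convergence to [g z] thus follows from differentiability. *)
have : (fun h : R => q f h * (g z + h * q g h) + f z * q g h) @ W -->
    a * (g z + 0 * b) + f z * b.
  apply: cvgD; last exact: cvgMl_tmp gb.
  apply: cvgM; first exact: fa.
  by apply: cvgD; [exact: cvg_cst | apply: cvgM h0 gb].
rewrite mul0r addr0; apply: cvg_trans; apply: near_eq_cvg.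
apply: nearW => h /=; rewrite /q.
(* The identity is proved for all [h]; at [h = 0] both sides vanish because [0^-1 = 0]. *)
have [->|h0'] := eqVneq h 0; first by rewrite invr0; ring.
by field.
Qed.

Lemma is_pd_eq f a b : a = b -> is_pd D f mu z a -> is_pd D f mu z b.
Proof. by move=> ->. Qed.

Lemma is_pd_pderivable f a : is_pd D f mu z a -> pderivable D f mu z.
Proof. by move=> fa; apply/cvg_ex; exists a. Qed.

Lemma is_pd_pd f a : ProperFilter W -> is_pd D f mu z a -> pd D mu f z = a.
Proof. by move=> FW; apply: cvg_lim. Qed.

End is_pd_rules.

Arguments is_pdZ {R D mu z} k [f a] _.

(** * Geometry of the space-time domain *)

Lemma ord2_cases (i : 'I_2) : i = 0 \/ i = 1.
Proof. by case: i => -[|[|//]] i; [left|right]; apply/val_inj. Qed.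

(** Move right unless [t] is the right end, and then left, by half of the smaller of [e] and the
    room available. *)
Lemma subinterval_near (R : realType) (lo hi t e : R) :
  lo < hi -> lo <= t <= hi -> 0 < e ->
  exists2 h, 0 < `|h| < e & lo < t + h < hi.
Proof.
move=> lohi /andP[lot thi] e0.
have [thi'|hit] := ltP t hi.
  have [eh|he] := leP e (hi - t).
    by exists (e / 2); [rewrite ger0_norm|]; lra.
  by exists ((hi - t) / 2); [rewrite ger0_norm|]; lra.
have [eh|he] := leP e (t - lo).
  by exists (- (e / 2)); [rewrite normrN ger0_norm|]; lra.
by exists (- ((t - lo) / 2)); [rewrite normrN ger0_norm|]; lra.
Qed.

(** Arbitrarily small nonzero increments stay in the domain, even at [t = 0] and [t = tau], so
    one-sided derivatives have unique values. *)
Lemma spacetime_proper (R : realType) (a1 a2 tau : R) (mu : 'I_2)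
    (z : 'rV[R]_2) :
  a1 < a2 -> 0 < tau -> spacetime a1 a2 tau z ->
  ProperFilter
    (within [set h : R | spacetime a1 a2 tau (z + h *: delta_mx 0 mu)] 0^').
Proof.
move=> ha htau [zt zx]; apply: Build_ProperFilter_ex => P.
move=> /nbhs_ballP[e /= e0 eP].
suff [h /andP[h0 he] Dh] : exists2 h, 0 < `|h| < e &
    spacetime a1 a2 tau (z + h *: delta_mx 0 mu).
  exists h; apply: eP => //; last by rewrite -normr_gt0.
  by rewrite /ball /= sub0r normrN.
have zx' : a1 <= z 0 1 <= a2 by lra.
have [->|->] := ord2_cases mu.
- have [h he hD] := subinterval_near htau zt e0.
  by exists h => //; split; rewrite !mxE /=; lra.
- have [h he hD] := subinterval_near ha zx' e0.
  by exists h => //; split; rewrite !mxE /=; lra.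
Qed.

Lemma spacetime_interior (R : realType) (a1 a2 tau : R) (z : 'rV[R]_2) :
  0 < z 0 0 < tau -> a1 < z 0 1 < a2 -> (spacetime a1 a2 tau)^° z.
Proof.
move=> zt zx.
have coord_itv (j : 'I_2) (a b : R) : a < z 0 j < b ->
    nbhs z [set y : 'rV[R]_2 | a < y 0 j < b].
  move=> zj; have zab : nbhs (z 0 j) [set x | a < x < b].
    have : z 0 j \in `]a, b[ by rewrite in_itv.
    by move=> /near_in_itvoo; apply: filterS => x; rewrite in_itv.
  exact: (@coord_continuous R 1 2 0 j z _ zab).
have H0 := coord_itv 0 _ _ zt; have H1 := coord_itv 1 _ _ zx.
apply: filterS (@filterI _ _ (nbhs_filter z) _ _ H0 H1) => y [/andP[y0 yt] yx].
by split=> //; rewrite (ltW y0) (ltW yt).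
Qed.

(** A small shift in [t] alone reaches the interior, since [x] already lies strictly between [a1]
    and [a2]. *)
Lemma spacetime_closure (R : realType) (a1 a2 tau : R) :
  0 < tau ->
  spacetime a1 a2 tau `<=` closure (spacetime a1 a2 tau)^°.
Proof.
move=> htau z [zt zx] B /(nbhs_line (delta_mx 0 0)) /nbhs_ballP[e /= e0 eB].
have [h /andP[h0 he] hD] := subinterval_near htau zt e0.
exists (z + h *: delta_mx 0 0); split.
  by apply: spacetime_interior; rewrite !mxE /=; lra.
by apply: eB; rewrite /ball /= sub0r normrN.
Qed.

(** * The derivatives of [sigma] and the conservation laws *)

Lemma derive_sigma (R : realType) (rho0 c : R) (mu : 'I_2) (p : 'rV[R]_2) :
  'D_(delta_mx 0 mu) (sigma rho0 c) p =
  (if mu == 0 then rho0 * p 0 0 else - c * p 0 1).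
Proof.
set l := if _ then _ else _.
(* [sigma] is quadratic, so for [h != 0] its difference quotient is exactly [l + h * k], with [k]
   half the second derivative. *)
pose k := if mu == 0 then rho0 / 2 else - c / 2.
apply: cvg_lim => //.
have : (fun h : R => l + h * k) @ 0^' --> l + 0 * k.
  apply: cvgD; first exact: cvg_cst.
  by apply: cvgMr_tmp; exact: nbhs_dnbhs.
rewrite mul0r addr0; apply: cvg_trans; apply: near_eq_cvg.
near=> h; have h0 : h != 0 by near: h; exact: nbhs_dnbhs_neq.
rewrite /= /sigma !mxE /GRing.scale /= /l /k.
have [->|->] := ord2_cases mu.
- by rewrite /=; field.
- by rewrite /=; field.
Unshelve. all: by end_near. Qed.

Theorem mainTheorem5 (R : realType) (a1 a2 tau rho0 c : R)
    (I : 'rV[R]_2 -> R)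
    (ha : a1 < a2) (htau : 0 < tau) (hrho0 : 0 < rho0)
    (hI : smooth_on (spacetime a1 a2 tau) I)
    (hEL : euler_lagrange (spacetime a1 a2 tau) rho0 c I) :
  let D := spacetime a1 a2 tau in
  let pi_ := tensorT D rho0 c I 0 0 in
  let flux := fun z : 'rV[R]_2 => pd D 0 I z * dsigma D rho0 c I 1 z in
  (forall eta : 'I_2,
     conservation_law D (fun mu : 'I_2 => tensorT D rho0 c I mu eta)) /\
  (forall z : 'rV[R]_2, D z ->
     [/\ pi_ z = rho0 * pd D 0 I z ^+ 2 - sigma_at D rho0 c I z,
         pderivable D pi_ 0 z,
         pderivable D flux 1 z &
         pd D 0 pi_ z + pd D 1 flux z = 0]).
Proof.
move=> D pi_ flux.
set u := pd D 0 I; set v := pd D 1 I.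
have ds0 : dsigma D rho0 c I 0 = fun y => rho0 * u y.
  by apply/funext => y; rewrite /dsigma derive_sigma /= mxE.
have ds1 : dsigma D rho0 c I 1 = fun y => - c * v y.
  by apply/funext => y; rewrite /dsigma derive_sigma /= mxE.
(* [sigma_at] and the entries of the tensor are put in the shape of sums of scaled products, to
   which [is_pdD], [is_pdZ] and [is_pdM] apply directly. *)
have sE : sigma_at D rho0 c I =
    fun y => 2^-1 * rho0 * (u y * u y) + - (2^-1 * c) * (v y * v y).
  by apply/funext => y; rewrite /sigma_at /sigma !mxE -/u -/v; ring.
have T00 : tensorT D rho0 c I 0 0 =
    fun y => rho0 * (u y * u y) + -1 * sigma_at D rho0 c I y.
  by apply/funext => y; rewrite /tensorT ds0 /= -/u; ring.
have T10 : tensorT D rho0 c I 1 0 = fun y => - c * (u y * v y).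
  by apply/funext => y; rewrite /tensorT ds1 /= -/u; ring.
have T01 : tensorT D rho0 c I 0 1 = fun y => rho0 * (u y * v y).
  by apply/funext => y; rewrite /tensorT ds0 /= -/v; ring.
have T11 : tensorT D rho0 c I 1 1 =
    fun y => - c * (v y * v y) + -1 * sigma_at D rho0 c I y.
  by apply/funext => y; rewrite /tensorT ds1 /= -/v; ring.
have fluxE : flux = tensorT D rho0 c I 1 0.
  by apply/funext => y; rewrite T10 /flux ds1 -/u; ring.
(* The single number [ux] serves as both the [x]-derivative of [u] and the [t]-derivative of [v]. *)
have Tpd z : D z -> exists ut ux vx : R,
    [/\ rho0 * ut - c * vx = 0,
     is_pd D (tensorT D rho0 c I 0 0) 0 z (rho0 * u z * ut + c * v z * ux),
     is_pd D (tensorT D rho0 c I 1 0) 1 z (- c * (u z * vx + v z * ux)),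
     is_pd D (tensorT D rho0 c I 0 1) 0 z (rho0 * (ut * v z + u z * ux)) &
     is_pd D (tensorT D rho0 c I 1 1) 1 z
       (- c * v z * vx - rho0 * u z * ux)].
  move=> Dz.
  have W0 := spacetime_proper 0 ha htau Dz.
  have W1 := spacetime_proper 1 ha htau Dz.
  have [_ du] := hI [:: 0]; have [_ dv] := hI [:: 1].
  have u0 : is_pd D u 0 z (pd D 0 u z) := du 0 z Dz.
  have u1 : is_pd D u 1 z (pd D 1 u z) := du 1 z Dz.
  have v0 : is_pd D v 0 z (pd D 0 v z) := dv 0 z Dz.
  have v1 : is_pd D v 1 z (pd D 1 v z) := dv 1 z Dz.
  have vu : pd D 0 v z = pd D 1 u z.
    by apply: pd_comm => //; apply: spacetime_closure.
  rewrite vu in v0.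
  exists (pd D 0 u z), (pd D 1 u z), (pd D 1 v z).
  have s0 := is_pdD (is_pdZ (2^-1 * rho0) (is_pdM u0 u0))
                    (is_pdZ (- (2^-1 * c)) (is_pdM v0 v0)).
  have s1 := is_pdD (is_pdZ (2^-1 * rho0) (is_pdM u1 u1))
                    (is_pdZ (- (2^-1 * c)) (is_pdM v1 v1)).
  rewrite -sE in s0 s1.
  split.
  - have [_] := hEL z Dz; rewrite big_ord_recl big_ord1 /=.
    rewrite (_ : lift ord0 ord0 = 1); last exact/val_inj.
    rewrite -/D ds0 ds1 (is_pd_pd W0 (is_pdZ rho0 u0)).
    by rewrite (is_pd_pd W1 (is_pdZ (- c) v1)) mulNr.
  - rewrite T00.
    apply: is_pd_eq (is_pdD (is_pdZ rho0 (is_pdM u0 u0)) (is_pdZ (-1) s0)).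
    by move: (u z) (v z) (pd D 0 u z) (pd D 1 u z) (pd D 1 v z) => *; field.
  - rewrite T10; apply: is_pd_eq (is_pdZ (- c) (is_pdM u1 v1)).
    by move: (u z) (v z) (pd D 0 u z) (pd D 1 u z) (pd D 1 v z) => *; ring.
  - by rewrite T01; exact: is_pdZ (is_pdM u0 v0).
  - rewrite T11.
    apply: is_pd_eq (is_pdD (is_pdZ (- c) (is_pdM v1 v1)) (is_pdZ (-1) s1)).
    by move: (u z) (v z) (pd D 0 u z) (pd D 1 u z) (pd D 1 v z) => *; field.
have Tcons eta : conservation_law D (fun mu => tensorT D rho0 c I mu eta).
  move=> z Dz.
  have W0 := spacetime_proper 0 ha htau Dz.
  have W1 := spacetime_proper 1 ha htau Dz.
  have [ut [ux [vx [EL p00 p10 p01 p11]]]] := Tpd z Dz.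
  rewrite big_ord_recl big_ord1 /= (_ : lift ord0 ord0 = 1); last exact/val_inj.
  have [->|->] := ord2_cases eta; split.
  - by move=> mu; have [->|->] := ord2_cases mu; [exact: is_pd_pderivable p00|
       exact: is_pd_pderivable p10].
  (* The terms [c * v z * ux] cancel, leaving [u z] times the Euler-Lagrange expression. *)
  - rewrite (is_pd_pd W0 p00) (is_pd_pd W1 p10).
    by rewrite -[RHS](mulr0 (u z)) -EL; ring.
  - by move=> mu; have [->|->] := ord2_cases mu; [exact: is_pd_pderivable p01|
       exact: is_pd_pderivable p11].
  (* Here the terms [rho0 * u z * ux] cancel, leaving [v z] times the Euler-Lagrange expression. *)
  - rewrite (is_pd_pd W0 p01) (is_pd_pd W1 p11).
    by rewrite -[RHS](mulr0 (v z)) -EL; ring.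
(* The balance law for [pi_] is the case [eta = 0], as [flux] is the entry with [mu = 1]. *)
split=> // z Dz; have [dT sT] := Tcons 0 z Dz; split.
- by rewrite /pi_ T00; ring.
- exact: dT 0.
- by rewrite fluxE; exact: dT 1.
- move: sT; rewrite big_ord_recl big_ord1 /= (_ : lift ord0 ord0 = 1) ?fluxE //.
  exact/val_inj.
Qed.
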